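(* Let $G$ be a finite group. If the difference subgroup graph $D(G)$ is triangle-free or bipartite, then $G$ is nilpotent.
   Context: For a finite group $G$, the difference subgroup graph $D(G)$ is the undirected graph whose vertices are the non-trivial proper subgroups of $G$, with two distinct vertices $H$ and $K$ adjacent if and only if $\langle H,K\rangle = G$ and $HK\neq G$, where $HK=\{hk : h\in H,\ k\in K\}$. *)

(* Defs.v *)
From mathcomp Require Import all_boot all_fingroup all_solvable.

Set Implicit Arguments.
Unset Strict Implicit.
Unset Printing Implicit Defensive.

Local Open Scope group_scope.

Definition triangle_free (T : finType) (e : rel T) : Prop :=
  ~ exists x y z : T, [/\ e x y, e y z & e z x].

(* The parts A and ~: A are allowed to be empty. *)
Definition bipartite (T : finType) (e : rel T) : Prop :=
  exists A : {set T}, forall x y : T, e x y -> (x \in A) != (y \in A).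

Section DifferenceSubgroupGraph.

Variables (gT : finGroupType) (G : {group gT}).

Definition nontriv_proper_subgroup : finType :=
  {H : {group gT} | (H :!=: 1) && (H \proper G)}.

Definition diff_subgroup_graph : rel nontriv_proper_subgroup :=
  [rel H K : nontriv_proper_subgroup |
    [&& H != K, val H <*> val K :==: G & val H * val K :!=: G]].

Lemma diff_subgroup_graph_irr : irreflexive diff_subgroup_graph.
Proof. by move=> H; rewrite /diff_subgroup_graph /= eqxx. Qed.

Lemma diff_subgroup_graph_sym : symmetric diff_subgroup_graph.
Proof.
move=> H K; rewrite /diff_subgroup_graph /= eq_sym joingC; congr [&& _, _ & ~~ _].
by rewrite -(inj_eq invg_inj) invMg !invGid.
Qed.

End DifferenceSubgroupGraph.

Arguments diff_subgroup_graph {gT} G H K : rename.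

(* Main.v *)
(** If every maximal subgroup of [G] is normal then [G] is nilpotent, because
    the normalizer of a non-normal Sylow subgroup would lie in a normal maximal
    subgroup, against the Frattini argument. So a non-nilpotent [G] has a
    non-normal maximal subgroup [M]. Distinct conjugates of [M] generate [G],
    but their product set is never [G], so they form a clique in the graph;
    its size is [#|G : M| > 2], as subgroups of index 2 are normal. *)

Require Import Defs.
From mathcomp Require Import all_boot all_fingroup all_solvable.

Set Implicit Arguments.
Unset Strict Implicit.
Unset Printing Implicit Defensive.

Local Open Scope group_scope.

Lemma bipartite_triangle_free (T : finType) (e : rel T) :
  bipartite e -> triangle_free e.
Proof.
case=> A parA [x [y [z [/parA exy /parA eyz /parA ezx]]]].
by move: exy eyz ezx; do 3![case: (_ \in A)].
Qed.

Section MaximalSubgroups.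

Variable gT : finGroupType.
Implicit Types G H K M : {group gT}.

(** A normal Sylow subgroup is a nilpotent normal subgroup, hence lies in the Fitting subgroup, and
    the Sylow subgroups together generate [G]. *)
Lemma nilpotent_Sylow_normal G :
  (forall P : {group gT}, Sylow G P -> P <| G) -> nilpotent G.
Proof.
move=> nsylG; suff sGF: G \subset 'F(G) by apply: nilpotentS sGF (Fitting_nil G).
rewrite -{1}(Sylow_gen G) gen_subG; apply/bigcupsP=> P sylP.
by rewrite Fitting_max ?nsylG //; case/SylowP: sylP => p _ /pHall_pgroup/pgroup_nil.
Qed.

Lemma nilpotent_maximal_normal G :
  (forall M, maximal M G -> M <| G) -> nilpotent G.
Proof.
move=> nmaxG; apply: nilpotent_Sylow_normal => P /SylowP[p _ sylP].
have sPG := pHall_sub sylP.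
case: (maximal_exists (subsetIl G 'N(P))) => [defN | [M maxM sNM]].
  by rewrite /normal sPG -{1}defN subsetIr.
have [sMG _] := andP (maxgroupp maxM).
have sPM: P \subset M by apply: subset_trans sNM; rewrite subsetI sPG normG.
(* Frattini gives [M * 'N_G(P) = G], and the left side collapses to [M] since ['N_G(P)] lies in
   [M]. *)
have := Frattini_arg (nmaxG M maxM) (pHall_subl sPM sMG sylP).
by rewrite mulGSid // => defG; move: (maxgroupp maxM); rewrite defG properxx.
Qed.

(** Write [z = h * k] with [h] in [H] and [k] in [H :^ z]. Then [H :^ z = H :^ k], while [k] also
    normalizes [H :^ z]; cancelling conjugation by [k] leaves [H :^ z = H]. *)
Lemma mulg_conjg_eq G H z : z \in G -> H * H :^ z = G -> H :^ z = H.
Proof.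
move=> Gz defG; move: Gz; rewrite -defG => /mulsgP[h k Hh HZk defz].
have defHz: H :^ z = H :^ k by rewrite defz conjsgM conjGid.
by rewrite defHz; apply: (@conjsg_inj _ k); rewrite /= -defHz (conjGid HZk).
Qed.

Lemma maximal_join_neq G H K :
  maximal H G -> maximal K G -> H :!=: K -> H <*> K = G.
Proof.
move=> maxH maxK neqHK.
have [[prHG maxH'] [prKG maxK']] := (maxgroupP maxH, maxgroupP maxK).
apply/eqP; rewrite eqEproper join_subG !proper_sub //=.
(* A proper join would equal both [H] and [K] by maximality. *)
apply: contra neqHK => prHK; apply/eqP.
by rewrite -(maxH' _ prHK (joing_subl H K)) (maxK' _ prHK (joing_subr H K)).
Qed.

(** A non-normal maximal subgroup is its own normalizer in [G], so its conjugates are counted by its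
    index, which is neither 1 nor 2. *)
Lemma card_conjugates_maximal_gt2 G M :
  maximal M G -> ~~ (M <| G) -> 2 < #|M :^: G|.
Proof.
move=> maxM not_nMG; have [prMG maxM'] := maxgroupP maxM.
have sMG := proper_sub prMG.
have sMN: M \subset 'N_G(M) by rewrite subsetI sMG normG.
have prN: 'N_G(M) \proper G.
  rewrite properEneq subsetIl andbT; apply: contra not_nMG => /eqP defN.
  by rewrite /normal sMG -{1}defN subsetIr.
rewrite card_conjugates (maxM' _ prN sMN).
rewrite ltn_neqAle eq_sym indexg_gt1 proper_subn // andbT.
by apply: contra not_nMG => /eqP/index2_normal->.
Qed.

Lemma maximal_conjugates_adjacent G M (H K : nontriv_proper_subgroup G) :
  maximal M G -> (val H : {set gT}) \in M :^: G ->
  (val K : {set gT}) \in M :^: G -> H != K -> diff_subgroup_graph G H K.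
Proof.
move=> maxM /imsetP[x Gx defH] /imsetP[y Gy defK] neqHK.
have max_conj z L: z \in G -> L = M :^ z -> maximal L G.
  by move=> Gz ->; rewrite -(conjGid Gz) maximalJ.
have neqHK': val H :!=: val K by [].
rewrite /diff_subgroup_graph /= neqHK /=.
rewrite (maximal_join_neq (max_conj _ _ Gx defH) (max_conj _ _ Gy defK)) //.
rewrite eqxx /=; apply: contra neqHK' => /eqP defG.
(* Two conjugates of [M] are conjugate to each other in [G], which brings the product into the form
   [H * H :^ z]. *)
have defKH: val K = val H :^ (x^-1 * y) :> {set gT}.
  by rewrite defH defK -conjsgM mulKVg.
by rewrite defKH (@mulg_conjg_eq G) -?defKH // groupM ?groupV.
Qed.

Lemma maximal_conjugate_vertex G M (A : {set gT}) :
  M :!=: 1 -> M \proper G -> A \in M :^: G ->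
  exists H : nontriv_proper_subgroup G, val H = A :> {set gT}.
Proof.
move=> ntM prMG /imsetP[x Gx ->].
have vertMx: ((M :^ x)%G :!=: 1) && ((M :^ x)%G \proper G).
  rewrite /= -{1}(conjGid Gx) properJ prMG andbT.
  by rewrite -(conjs1g x) (inj_eq (@conjsg_inj _ x)).
by exists (Sub (M :^ x)%G vertMx); rewrite SubK.
Qed.

End MaximalSubgroups.

Theorem theorem2p2 (gT : finGroupType) (G : {group gT}) :
  triangle_free (diff_subgroup_graph G) \/ bipartite (diff_subgroup_graph G) ->
  nilpotent G.
Proof.
move=> tf_or_bip.
have{tf_or_bip} tfG: triangle_free (diff_subgroup_graph G).
  by case: tf_or_bip => // /bipartite_triangle_free.
apply: nilpotent_maximal_normal => M maxM; apply/idPn=> not_nMG.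
have prMG := maxgroupp maxM.
(* Vertices must be non-trivial; a trivial [M] would be normal. *)
have ntM: M :!=: 1.
  by apply: contraNneq not_nMG => ->; rewrite normal1.
have /card_gt2P[A [B [C [[mA mB mC] [neqAB neqBC neqCA]]]]] :=
  card_conjugates_maximal_gt2 maxM not_nMG.
have [H defA] := maximal_conjugate_vertex ntM prMG mA.
have [K defB] := maximal_conjugate_vertex ntM prMG mB.
have [L defC] := maximal_conjugate_vertex ntM prMG mC.
rewrite -{}defA -{}defB -{}defC in mA mB mC neqAB neqBC neqCA.
by apply: tfG; exists H, K, L; split; apply: (maximal_conjugates_adjacent maxM).
Qed.
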